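(* In the (universal) hyperbolic plane with absolute conic $\mathcal{N}\colon x_1^2+x_2^2-x_0^2=0$, let $$\mathcal{C}\colon \lambda(x_1^2+x_2^2-x_0^2)+x_1^2+x_2^2=0,\qquad \lambda\in\mathbb{R}\setminus\{0,-1\},$$ be a circle with two conjugate complex points of tangency with $\mathcal{N}$. The Frégier locus of $\mathcal{C}$ is singular precisely for $\lambda=-2$, and in this case it is the span of the two points of tangency, i.e. the line $x_0=0$.
   Context: Points have homogeneous coordinates $[x_0,x_1,x_2]$; points inside and outside $\mathcal{N}$ are treated equally, and the Frégier locus is considered in the complex projective plane. Two lines are orthogonal if they are conjugate with respect to $\mathcal{N}$ (one contains the pole of the other with respect to $\mathcal{N}$). A conic is regular if its symmetric coefficient matrix is invertible. A circle is a regular conic having double contact with $\mathcal{N}$, i.e. the base points of the pencil spanned by the conic and $\mathcal{N}$ form precisely two pairs of coinciding points; here the points of tangency are $[0,1,\pm\mathrm{i}]$. For a regular conic $\mathcal{C}$ and $p\in\mathcal{C}$, the Frégier point $f(\mathcal{C},p)$ is the point common to the hypotenuses $q\vee r$ of all right triangles $p,q,r$ inscribed into $\mathcal{C}$ with right angle at $p$; equivalently, it is the pole with respect to $\mathcal{C}$ of the line joining the second intersection points with $\mathcal{C}$ of the two (possibly complex) tangents of $\mathcal{N}$ through $p$ (if these second intersection points coincide, the line is the tangent of $\mathcal{C}$ there; in particular $f(\mathcal{C},p)=p$ if $\mathcal{C}$ and $\mathcal{N}$ are tangent at $p$). The Frégier locus is $\mathcal{F}=\{f(\mathcal{C},p)\mid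 p\in\mathcal{C}\}$; it is called singular if it is not a regular conic. *)

(* Defs.v *)
From mathcomp Require Import all_boot all_order all_algebra complex.
From mathcomp Require Import classical_sets reals.

Set Implicit Arguments.
Unset Strict Implicit.
Unset Printing Implicit Defensive.

Import GRing.Theory.

Local Open Scope ring_scope.
Local Open Scope classical_set_scope.

(* Linear subspaces of K^3 are represented by row spaces (%MS).  A point of the
   projective plane is represented by any nonzero row vector of homogeneous
   coordinates, so that (p == q)%MS is equality of points, and a line by a
   matrix of rank 2; the join of p and q is (p + q)%MS.  Sets of points are
   sets of nonzero vectors closed under proportionality. *)
Section Plane.
Variable K : fieldType.
Implicit Types (A N : 'M[K]_3) (p q r f g s t : 'rV[K]_3) (F : set 'rV[K]_3).

Definition pt (x0 x1 x2 : K) : 'rV[K]_3 := \row_j [:: x0; x1; x2]`_j.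

Definition points m (L : 'M[K]_(m, 3)) : set 'rV[K]_3 :=
  [set p | p != 0 /\ (p <= L)%MS].

Definition diag3 (a b c : K) : 'M[K]_3 := diag_mx (pt a b c).

Definition conic A : set 'rV[K]_3 := [set p | p != 0 /\ p *m A *m p^T = 0].

Definition regular A : bool := (A^T == A) && (A \in unitmx).

(* All vectors conjugate with respect to A to every vector of L: the polar line
   of L if L is a point, the pole of L if L is a line. *)
Definition polar m A (L : 'M[K]_(m, 3)) : 'M[K]_3 := kermx (A *m L^T).

Definition orthogonal N (L M : 'M[K]_3) : bool :=
  (polar N L <= M)%MS || (polar N M <= L)%MS.

(* At a point of a regular conic, the tangent is the polar line. *)
Definition tangent_at N A p : Prop :=
  [/\ conic N p, conic A p & (polar N p == polar A p)%MS].

(* For regular N and A over an algebraically closed field: the base points of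
   the pencil spanned by N and A are s, s, t, t with s <> t.  Tangency makes
   each of the two common points at least double, and the multiplicities add
   up to 4. *)
Definition double_contact N A s t : Prop :=
  [/\ s != 0 /\ t != 0, ~~ (s == t)%MS,
      conic N `&` conic A = [set p | (p == s)%MS \/ (p == t)%MS],
      tangent_at N A s & tangent_at N A t].

Definition circle N A s t : Prop := regular A /\ double_contact N A s t.

Definition right_triangle N A p q r : Prop :=
  [/\ conic A p, conic A q, conic A r, \rank (p + q + r)%MS = 3%N
    & orthogonal N (p + q)%MS (p + r)%MS].

(* f = f(A, p) for p on A.  If N and A are not tangent at p, the intersection
   of all hypotenuses is exactly the point f.  If they are tangent at p, there
   are no right triangles at p, and f(A, p) = p by convention. *)
Definition fregier_point N A p f : Prop :=
  [/\ f != 0,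
      tangent_at N A p -> (f == p)%MS
    & ~ tangent_at N A p ->
      forall g, (forall q r, right_triangle N A p q r -> (g <= q + r)%MS)
                <-> (g <= f)%MS].

Definition fregier_locus N A : set 'rV[K]_3 :=
  [set f | exists2 p, conic A p & fregier_point N A p f].

Definition singular F : Prop := ~ exists2 A, regular A & F = conic A.

End Plane.

Section Circle.
Variable R : realType.

Definition absolute : 'M[R[i]]_3 := diag3 (-1) 1 1.

Definition circle_mx (lambda : R) : 'M[R[i]]_3 :=
  lambda%:C%C *: absolute + diag3 0 1 1.

End Circle.

Arguments absolute {R}.

(* Main.v *)
(** The Fregier point of p on C turns out to be the image of p under the linear
    map diag(l + 2, l, l).  That every hypotenuse of a right triangle p, q, r
    passes through it is a Gram determinant computation with the form of C,
    because that form is (l + 1) times the form of N plus the rank-one form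
    x0 y0; two explicit right triangles show that no other point lies on all
    hypotenuses.  Hence the Fregier locus is the image of C under this map: a
    regular conic if l + 2 <> 0, and for l = -2 the projection of C from
    [1,0,0] onto the line x0 = 0, which is surjective over the complex numbers. *)
Require Import Defs.
From mathcomp Require Import all_boot all_order all_algebra complex.
From mathcomp Require Import classical_sets reals.
From mathcomp Require Import ring.
Import GRing.Theory Num.Theory.

Set Implicit Arguments.
Unset Strict Implicit.

Local Open Scope ring_scope.
Local Open Scope classical_set_scope.

(** * Coordinates, cross products and determinants in dimension three *)

Section Coordinates.
Variable K : fieldType.
Implicit Types (p q r v w : 'rV[K]_3).

Lemma pt0 (x0 x1 x2 : K) : pt x0 x1 x2 0 0 = x0. Proof. by rewrite mxE. Qed.
Lemma pt1 (x0 x1 x2 : K) : pt x0 x1 x2 0 1 = x1. Proof. by rewrite mxE. Qed.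
Lemma pt2 (x0 x1 x2 : K) : pt x0 x1 x2 0 2 = x2. Proof. by rewrite mxE. Qed.
Definition ptE := (pt0, pt1, pt2).

Lemma sum_ord3 (V : nmodType) (F : 'I_3 -> V) : \sum_i F i = F 0 + F 1 + F 2.
Proof.
rewrite !big_ord_recl big_ord0 addr0 addrA.
by congr (F _ + F _ + F _); apply: val_inj.
Qed.

Lemma eq_row3 p q : p 0 0 = q 0 0 -> p 0 1 = q 0 1 -> p 0 2 = q 0 2 -> p = q.
Proof.
move=> e0 e1 e2; apply/rowP=> -[[|[|[|//]]] lt_i3].
- by rewrite (_ : Ordinal _ = 0) //; apply: val_inj.
- by rewrite (_ : Ordinal _ = 1) //; apply: val_inj.
- by rewrite (_ : Ordinal _ = 2) //; apply: val_inj.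
Qed.

Lemma row3_eq0 p : (p == 0) = [&& p 0 0 == 0, p 0 1 == 0 & p 0 2 == 0].
Proof.
apply/eqP/and3P => [->|[/eqP e0 /eqP e1 /eqP e2]]; first by rewrite !mxE eqxx.
by apply: eq_row3; rewrite !mxE.
Qed.

Lemma mul_row_diag3 a b c p :
  p *m diag3 a b c = pt (p 0 0 * a) (p 0 1 * b) (p 0 2 * c).
Proof. by rewrite mul_mx_diag; apply: eq_row3; rewrite !mxE. Qed.

Definition dot p q : K := p 0 0 * q 0 0 + p 0 1 * q 0 1 + p 0 2 * q 0 2.

Lemma mul_row_tr p q : p *m q^T = (dot p q)%:M.
Proof. by rewrite [LHS]mx11_scalar mxE sum_ord3 !mxE. Qed.

Lemma dot_eq0 p q : p *m q^T = 0 <-> dot p q = 0.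
Proof.
rewrite mul_row_tr; split=> [/matrixP/(_ 0 0)|->]; last exact: raddf0.
by rewrite !mxE.
Qed.

Definition cross p q : 'rV[K]_3 :=
  pt (p 0 1 * q 0 2 - p 0 2 * q 0 1) (p 0 2 * q 0 0 - p 0 0 * q 0 2)
     (p 0 0 * q 0 1 - p 0 1 * q 0 0).

Definition triple p q r : K := dot p (cross q r).

Lemma det3 (A : 'M[K]_3) :
  \det A = A 0 0 * (A 1 1 * A 2 2 - A 1 2 * A 2 1)
         + A 0 1 * (A 1 2 * A 2 0 - A 1 0 * A 2 2)
         + A 0 2 * (A 1 0 * A 2 1 - A 1 1 * A 2 0).
Proof.
(* The expansion indexes entries by compound lifted ordinals; passing through [inord] of their
   numerical values makes equal entries syntactically equal for [ring]. *)
pose M i j := A (inord i) (inord j).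
have EA i j : A i j = M i j by rewrite /M !inord_val.
rewrite (expand_det_row _ 0) !big_ord_recl big_ord0 /cofactor.
rewrite !(expand_det_row _ 0) !big_ord_recl !big_ord0 /cofactor !det_mx11.
by rewrite !mxE !EA /=; ring.
Qed.

Lemma rank_triple p q r : (\rank (p + q + r)%MS == 3%N) = (triple p q r != 0).
Proof.
pose P : 'M[K]_3 := \matrix_(i < 3) nth 0 [:: p; q; r] i.
have eP : (P :=: p + q + r)%MS.
  apply/eqmxP/andP; split.
    apply/row_subP=> -[[|[|[|//]]] lt_i3]; rewrite rowK /=.
    - exact: submx_trans (addsmxSl _ _) (addsmxSl _ _).
    - exact: submx_trans (addsmxSr _ _) (addsmxSl _ _).
    - exact: addsmxSr.
  rewrite !addsmx_sub; apply/andP; split; first (apply/andP; split).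
  - by rewrite (_ : p = row 0 P) ?row_sub ?rowK.
  - by rewrite (_ : q = row 1 P) ?row_sub ?rowK.
  - by rewrite (_ : r = row 2 P) ?row_sub ?rowK.
have -> : triple p q r = \det P.
  by rewrite det3 !mxE /triple /dot /cross !ptE /=; ring.
by rewrite -unitfE -[_ \is a _]/(P \in unitmx) -row_full_unit /row_full eP.
Qed.

Lemma span2P p q g :
  (g <= p + q)%MS <-> exists x y, g = x *: p + y *: q.
Proof.
split=> [/sub_addsmxP[u ->]|[x [y ->]]].
  exists (u.1 0 0), (u.2 0 0).
  by rewrite {1}[u.1]mx11_scalar {1}[u.2]mx11_scalar !mul_scalar_mx.
by rewrite addmx_sub_adds ?scalemx_sub.
Qed.

(** Cramer's rule: in the basis [p], [q], [r], the coordinate of [g] along [p] is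
    [triple g q r / triple p q r]. *)
Lemma sub_span2 p q r g : triple p q r != 0 ->
  (g <= q + r)%MS <-> triple g q r = 0.
Proof.
move=> ntr; rewrite span2P; split=> [[x [y ->]]|g0].
  by rewrite /triple /dot /cross !ptE !mxE; ring.
exists (triple p g r / triple p q r), (triple p q g / triple p q r).
have E : triple p q r *: g =
    triple g q r *: p + triple p g r *: q + triple p q g *: r.
  by apply: eq_row3; rewrite /triple /dot /cross !(mxE, ptE) /=; ring.
apply: (scalerI ntr); rewrite E g0 scale0r add0r scalerDr !scalerA.
by rewrite !(mulrC (triple p q r)) !mulfVK.
Qed.

End Coordinates.

(** * Polarity and orthogonality in coordinates *)

Section Conics.
Variable K : fieldType.
Implicit Types (A : 'M[K]_3) (p q r u v : 'rV[K]_3) (a b c : K).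

Lemma conicP A p : conic A p <-> p != 0 /\ dot (p *m A) p = 0.
Proof. by split=> -[p0 /dot_eq0]. Qed.

Lemma regular_diag3 a b c : regular (diag3 a b c) = (a * b * c != 0).
Proof.
rewrite /regular tr_diag_mx eqxx unitmxE det3 !mxE /= unitfE.
by congr (_ != 0); rewrite !mulr1n !mulr0n; ring.
Qed.

(** The matrix [(p + q)%MS] is known only up to its row space. Transposition moves it to the left of
    an inclusion, where it splits into the conditions for [p] and [q]. *)
Lemma sub_polar_line A p q v :
  (v <= polar A (p + q)%MS)%MS <-> dot (v *m A) p = 0 /\ dot (v *m A) q = 0.
Proof.
have E m (L : 'M[K]_(m, 3)) :
    (L <= kermx (v *m A)^T)%MS <-> v *m A *m L^T = 0.
  have -> : (L <= kermx (v *m A)^T)%MS = (v *m A *m L^T == 0).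
    rewrite sub_kermx -[L in LHS]trmxK -trmx_mul.
    by rewrite -(inj_eq (@trmx_inj _ _ _)) trmxK trmx0.
  exact: iff_sym (rwP eqP).
rewrite -!dot_eq0 -!E; transitivity (p + q <= kermx (v *m A)^T)%MS.
  by rewrite E -mulmxA; exact: iff_sym (rwP sub_kermxP).
by rewrite addsmx_sub; split=> [/andP|/andP].
Qed.

(** Up to the factor [triple p q r], the vectors [cross q r], [cross r p], [cross p q] form the
    basis dual to [p], [q], [r]; two of the three coefficients of [u] vanish. *)
Lemma triple_dot_eq0 p q r u : triple p q r != 0 ->
  dot u p = 0 -> dot u q = 0 -> exists c, u = c *: cross p q.
Proof.
move=> ntr up uq; exists (dot u r / triple p q r).
have E : triple p q r *: u =
    dot u p *: cross q r + dot u q *: cross r p + dot u r *: cross p q.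
  by apply: eq_row3; rewrite /triple /dot /cross !(mxE, ptE) /=; ring.
apply: (scalerI ntr); rewrite E up uq !scale0r !add0r scalerA.
by rewrite mulrC mulfVK.
Qed.

(** Multiplicativity of the determinant: the right side is the Gram determinant of [u], [v], [w]
    against [p], [q], [r]. *)
Lemma tripleM_dot u v w p q r :
  triple u v w * triple p q r =
    dot u p * (dot v q * dot w r - dot v r * dot w q)
  + dot u q * (dot v r * dot w p - dot v p * dot w r)
  + dot u r * (dot v p * dot w q - dot v q * dot w p).
Proof. by rewrite /triple /dot /cross !(mxE, ptE) /=; ring. Qed.

Local Notation N := (diag3 (-1) 1 1 : 'M[K]_3).

(** As [N] is its own inverse, the pole of the join of [p] and [q] is [cross p q *m N]. The
    resulting incidence condition is symmetric in [q] and [r], so both alternatives in [orthogonal]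
    reduce to it. *)
Lemma orthogonal_absolute p q r : triple p q r != 0 ->
  Defs.orthogonal N (p + q)%MS (p + r)%MS <->
  dot (cross p q *m N) (cross p r) = 0.
Proof.
have sub_join q' r' : triple p q' r' != 0 ->
    (polar N (p + q')%MS <= p + r')%MS <-> dot (cross p q' *m N) (cross p r') = 0.
  move=> ntr.
  have Ne v : v = v *m N *m N.
    by apply: eq_row3; rewrite !mul_row_diag3 !ptE; ring.
  rewrite -[X in _ <-> X]/(triple (cross p q' *m N) p r' = 0) -(@sub_span2 _ q').
    split=> [|sub_o]; last first.
      apply/row_subP=> i; have := row_sub i (polar N (p + q')%MS).
      move: (row i _) => v /sub_polar_line[vp vq].
      have [c E] := triple_dot_eq0 ntr vp vq.
      by rewrite [v]Ne E -scalemxAl scalemx_sub.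
    apply: submx_trans; apply/sub_polar_line; rewrite -Ne.
    by split; rewrite /dot /cross !(mxE, ptE) /=; ring.
  rewrite (_ : triple q' p r' = - triple p q' r') ?oppr_eq0 //.
  by rewrite /triple /dot /cross !(mxE, ptE) /=; ring.
move=> ntr.
have ntr' : triple p r q != 0.
  rewrite (_ : triple p r q = - triple p q r) ?oppr_eq0 //.
  by rewrite /triple /dot /cross !(mxE, ptE) /=; ring.
rewrite /Defs.orthogonal; split=> [/orP[/sub_join->//|/sub_join H]|/sub_join->//].
rewrite -[RHS](H ntr') !mul_row_diag3 /dot !ptE; ring.
Qed.

End Conics.

(** * Circles and their Fregier points *)

Section Circles.
Variables (K : numClosedFieldType) (l : K).
Hypotheses (l0 : l != 0) (l1 : l + 1 != 0).
Implicit Types (f g p q r v : 'rV[K]_3).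

Local Notation N := (diag3 (-1) 1 1 : 'M[K]_3).
Local Notation C := (diag3 (- l) (l + 1) (l + 1) : 'M[K]_3).

Lemma conic_circleP p : conic C p <->
  p != 0 /\ (l + 1) * (p 0 1 ^+ 2 + p 0 2 ^+ 2) = l * p 0 0 ^+ 2.
Proof.
have E : dot (p *m C) p = (l + 1) * (p 0 1 ^+ 2 + p 0 2 ^+ 2) - l * p 0 0 ^+ 2.
  by rewrite mul_row_diag3 /dot !ptE; ring.
rewrite conicP E.
by split=> -[-> H]; split=> //; [exact: subr0_eq | rewrite H subrr].
Qed.

Lemma conic_absoluteP p : conic N p <->
  p != 0 /\ p 0 1 ^+ 2 + p 0 2 ^+ 2 = p 0 0 ^+ 2.
Proof.
have E : dot (p *m N) p = p 0 1 ^+ 2 + p 0 2 ^+ 2 - p 0 0 ^+ 2.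
  by rewrite mul_row_diag3 /dot !ptE; ring.
rewrite conicP E.
by split=> -[-> H]; split=> //; [exact: subr0_eq | rewrite H subrr].
Qed.

(** The form of [C] is [l + 1] times that of [N] plus [x0 y0]. Hence common points have [x0 = 0],
    and there both conics have the same polar. *)
Lemma tangent_circleP p : conic C p -> tangent_at N C p <-> p 0 0 = 0.
Proof.
move=> Cp; have [p0 eC] := (conic_circleP p).1 Cp; split=> [[Np _ _]|z].
  have [_ eN] := (conic_absoluteP p).1 Np.
  apply/eqP; rewrite -sqrf_eq0; apply/eqP.
  transitivity ((l + 1) * p 0 0 ^+ 2 - l * p 0 0 ^+ 2); first by ring.
  by rewrite -eC eN subrr.
split=> //.
  apply/conic_absoluteP; split=> //; apply: (mulfI l1).
  by rewrite eC z; ring.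
have E : p *m C = (l + 1) *: (p *m N).
  by apply: eq_row3; rewrite !mul_row_diag3 !(ptE, mxE) /= ?z; ring.
have polarE A v : A^T = A -> (v <= polar A p)%MS = (p *m A *m v^T == 0).
  move=> sA; rewrite /polar sub_kermx -(inj_eq (@trmx_inj _ _ _)) trmx0.
  by rewrite !trmx_mul trmxK sA.
apply/rV_eqP => v.
rewrite !polarE ?tr_diag_mx // E -scalemxAl scaler_eq0 (negPf l1) //.
Qed.

(* The circle is invariant under the rotations about [1,0,0], so the Fregier
   point is a fixed linear function of the point; the factor [l + 2] is found at
   a point of the axis [x2 = 0]. *)
Definition fregier_map p := pt ((l + 2) * p 0 0) (l * p 0 1) (l * p 0 2).

Lemma fregier_mapZ (c : K) p : fregier_map (c *: p) = c *: fregier_map p.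
Proof. by apply: eq_row3; rewrite !(ptE, mxE) /=; ring. Qed.

Lemma fregier_map0 : fregier_map 0 = 0.
Proof. by rewrite -[X in fregier_map X](scale0r 0) fregier_mapZ scale0r. Qed.

Lemma fregier_map_hypotenuse p q r :
  right_triangle N C p q r -> (fregier_map p <= q + r)%MS.
Proof.
case=> /conicP[_ Cp] /conicP[_ Cq] /conicP[_ Cr] /eqP.
rewrite rank_triple => ntr /(orthogonal_absolute ntr) orth.
apply/(sub_span2 _ ntr).
have G := tripleM_dot (fregier_map p *m C) (q *m C) (r *m C) p q r.
have dC u v : dot (u *m C) v = dot (v *m C) u.
  by rewrite !mul_row_diag3 /dot !ptE; ring.
set A := dot (q *m C) r; set B := dot (r *m C) p; set D := dot (q *m C) p.
(* By Lagrange's identity the right angle means N(p,q) N(p,r) = N(p,p) N(q,r); here (l + 1) N(u,v)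
   is replaced by C(u,v) - u0 v0, and C(p,p) = 0. *)
have orth' : B * D - p 0 0 * (r 0 0 * D + q 0 0 * B - p 0 0 * A) = 0.
  have : (l + 1) ^+ 2 * dot (cross p q *m N) (cross p r)
         = B * D - p 0 0 * (r 0 0 * D + q 0 0 * B - p 0 0 * A)
           - dot (p *m C) p * (A - q 0 0 * r 0 0).
    rewrite /A /B /D !mul_row_diag3 /dot /cross !ptE; ring.
  by rewrite orth Cp mulr0 mul0r subr0.
have dF u : dot (fregier_map p *m C) u =
     l * (dot (p *m C) u - 2 * p 0 0 * u 0 0).
  by rewrite !mul_row_diag3 /dot !ptE; ring.
move: G; rewrite !dF Cp Cq Cr (dC r q) (dC p q) (dC p r) -/A -/B -/D => G.
(* The factor [- l * (l + 1) ^+ 2] is the determinant of [C]; the Gram determinant [G] turns out to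
   be a multiple of the expression in [orth']. *)
have : (- l * (l + 1) ^+ 2 * triple p q r) * triple (fregier_map p) q r = 0.
  transitivity (triple (fregier_map p *m C) (q *m C) (r *m C) * triple p q r).
    by rewrite !mul_row_diag3 /triple /dot /cross !ptE; ring.
  rewrite G; transitivity (2 * l * A *
    (B * D - p 0 0 * (r 0 0 * D + q 0 0 * B - p 0 0 * A))); first by ring.
  by rewrite orth' mulr0.
move/eqP; rewrite mulf_eq0 => /orP[|/eqP//].
by rewrite !mulf_eq0 oppr_eq0 (negPf l0) (negPf l1) (negPf ntr).
Qed.

(* The second points of intersection with C of the two perpendicular lines
   through p that have the directions [d = u e + v e'], [(u, v) = (1, w)] and
   [(w, - (l + 1))], with [e = (p1, p2)] and [e' = (- p2, p1)]. *)
Definition leg1 p w := pt ((w ^+ 2 + 1) * p 0 0)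
  ((w ^+ 2 - 1) * p 0 1 + 2 * w * p 0 2)
  ((w ^+ 2 - 1) * p 0 2 - 2 * w * p 0 1).
Definition leg2 p w := pt ((w ^+ 2 + (l + 1) ^+ 2) * p 0 0)
  (((l + 1) ^+ 2 - w ^+ 2) * p 0 1 - 2 * (l + 1) * w * p 0 2)
  (((l + 1) ^+ 2 - w ^+ 2) * p 0 2 + 2 * (l + 1) * w * p 0 1).

(** For [g = p] this shows that the triangle is not degenerate; for general [g] it is the equation
    of the hypotenuse, split into a part odd in [w] and a part even in [w], apart from the common
    even factor. *)
Lemma triple_legs p w g : triple g (leg1 p w) (leg2 p w) =
  2 * (w ^+ 2 + (l + 1)) *
  (w * (l * g 0 0 * (p 0 1 ^+ 2 + p 0 2 ^+ 2)
        - (l + 2) * p 0 0 * (g 0 1 * p 0 1 + g 0 2 * p 0 2))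
   + (l + 1 - w ^+ 2) * p 0 0 * (g 0 2 * p 0 1 - g 0 1 * p 0 2)).
Proof. by rewrite /triple /dot /cross !ptE; ring. Qed.

Lemma circle_norm_neq0 p : conic C p -> p 0 0 != 0 ->
  p 0 1 ^+ 2 + p 0 2 ^+ 2 != 0.
Proof.
case/conic_circleP=> _ eC z; apply/eqP => E; move: eC; rewrite E mulr0 => /eqP.
by rewrite eq_sym mulf_eq0 sqrf_eq0 (negPf z) (negPf l0).
Qed.

Lemma right_triangle_legs p w : conic C p -> p 0 0 != 0 ->
  w != 0 -> w ^+ 2 + (l + 1) != 0 -> right_triangle N C p (leg1 p w) (leg2 p w).
Proof.
move=> Cp z w0 wl; have [_ eC] := (conic_circleP p).1 Cp.
have ntr : triple p (leg1 p w) (leg2 p w) != 0.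
  rewrite triple_legs (_ : _ * _ =
    - 2 ^+ 2 * (w ^+ 2 + (l + 1)) * w * p 0 0 * (p 0 1 ^+ 2 + p 0 2 ^+ 2)); last ring.
  rewrite !mulf_neq0 ?circle_norm_neq0 // oppr_eq0 expf_neq0 // pnatr_eq0 //.
split=> //; last 2 first.
- by apply/eqP; rewrite rank_triple.
- apply/(orthogonal_absolute ntr); rewrite mul_row_diag3 /dot /cross !ptE.
  transitivity (2 ^+ 2 * w ^+ 2 * (p 0 1 ^+ 2 + p 0 2 ^+ 2) *
    ((l + 1) * (p 0 1 ^+ 2 + p 0 2 ^+ 2) - l * p 0 0 ^+ 2)); first ring.
  by rewrite eC subrr mulr0.
- apply/conic_circleP; split.
    apply: contra_neq ntr => ->; rewrite /triple /dot /cross !(ptE, mxE) /=; ring.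
  apply/eqP; rewrite -subr_eq0 !ptE; apply/eqP.
  transitivity ((w ^+ 2 + 1) ^+ 2 *
    ((l + 1) * (p 0 1 ^+ 2 + p 0 2 ^+ 2) - l * p 0 0 ^+ 2)); first ring.
  by rewrite eC subrr mulr0.
- apply/conic_circleP; split.
    apply: contra_neq ntr => ->; rewrite /triple /dot /cross !(ptE, mxE) /=; ring.
  apply/eqP; rewrite -subr_eq0 !ptE; apply/eqP.
  transitivity ((w ^+ 2 + (l + 1) ^+ 2) ^+ 2 *
    ((l + 1) * (p 0 1 ^+ 2 + p 0 2 ^+ 2) - l * p 0 0 ^+ 2)); first ring.
  by rewrite eC subrr mulr0.
Qed.

(** The last two conditions together say that w^4 differs from (l + 1)^2. So [w = 1] works unless (l
    + 1)^2 = 1, and then [w = 2] does, because 16 - 1 = 15 is nonzero. *)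
Lemma slope_exists : exists w : K,
  [/\ w != 0, w ^+ 2 + (l + 1) != 0 & l + 1 - w ^+ 2 != 0].
Proof.
have [E|E] := eqVneq ((l + 1) ^+ 2) 1; [exists 2|exists 1]; split;
  rewrite ?pnatr_eq0 ?oner_eq0 //.
- apply/eqP=> H; have : (15%:R : K) = 0.
    transitivity ((2 ^+ 2 + (l + 1)) * (2 ^+ 2 - (l + 1))
      + ((l + 1) ^+ 2 - 1)); first ring.
    by rewrite H E subrr mul0r addr0.
  by move/eqP; rewrite pnatr_eq0.
- apply/eqP=> H; have : (15%:R : K) = 0.
    transitivity (- (2 ^+ 2 + (l + 1)) * (l + 1 - 2 ^+ 2)
      + ((l + 1) ^+ 2 - 1)); first ring.
    by rewrite H E subrr mulr0 addr0.
  by move/eqP; rewrite pnatr_eq0.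
- apply: contra_neq E => H.
  by apply/eqP; rewrite -subr_eq0 -[X in _ == X](mulr0 l) -H; apply/eqP; ring.
- apply: contra_neq E => H.
  by apply/eqP; rewrite -subr_eq0 -[X in _ == X](mulr0 (l + 2)) -H; apply/eqP; ring.
Qed.

(* The slopes w and - w give two distinct hypotenuses. *)
Lemma sub_fregier_map p g : conic C p -> p 0 0 != 0 ->
  (forall q r, right_triangle N C p q r -> (g <= q + r)%MS) ->
  (g <= fregier_map p)%MS.
Proof.
move=> Cp z hyp; have [w [w0 wl lw]] := slope_exists.
pose n := p 0 1 ^+ 2 + p 0 2 ^+ 2; have n0 : n != 0 := circle_norm_neq0 Cp z.
(* [Y = 0] makes (g1, g2) parallel to (p1, p2), and [X = 0] then determines g0. The slopes [w] and
   [- w] yield two equations that separate [X] from [Y]. *)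
pose X := l * g 0 0 * n - (l + 2) * p 0 0 * (g 0 1 * p 0 1 + g 0 2 * p 0 2).
pose Y := g 0 2 * p 0 1 - g 0 1 * p 0 2.
have key s : s != 0 -> s ^+ 2 = w ^+ 2 ->
    s * X + (l + 1 - w ^+ 2) * p 0 0 * Y = 0.
  move=> s0 sw; have T : right_triangle N C p (leg1 p s) (leg2 p s).
    by apply: right_triangle_legs => //; rewrite sw.
  have [_ _ _ /eqP] := T; rewrite rank_triple => ntr _.
  move/hyp/(sub_span2 _ ntr)/eqP: T; rewrite triple_legs sw !mulf_eq0 pnatr_eq0.
  by rewrite (negPf wl) => /eqP.
have k1 := key w w0 erefl.
have k2 : - w * X + (l + 1 - w ^+ 2) * p 0 0 * Y = 0.
  by apply: key; rewrite ?oppr_eq0 ?sqrrN.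
have Y0 : Y = 0.
  apply/eqP; have : 2 * ((l + 1 - w ^+ 2) * p 0 0) * Y = 0.
    transitivity ((w * X + (l + 1 - w ^+ 2) * p 0 0 * Y)
      + (- w * X + (l + 1 - w ^+ 2) * p 0 0 * Y)); first by ring.
    by rewrite k1 k2 addr0.
  by move/eqP; rewrite !mulf_eq0 pnatr_eq0 (negPf lw) (negPf z).
have X0 : X = 0.
  by move/eqP: k1; rewrite Y0 mulr0 addr0 mulf_eq0 (negPf w0) => /eqP.
have ln : l * n != 0 by rewrite mulf_neq0.
(* Since [Y = 0], the pair (g1, g2) is (g1 p1 + g2 p2) / n times (p1, p2); the further division by
   [l] compensates for the scaling in [fregier_map]. *)
apply/sub_rVP; exists ((g 0 1 * p 0 1 + g 0 2 * p 0 2) / (l * n)).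
apply: (scalerI ln); rewrite scalerA [_ * (_ / _)]mulrC mulfVK //.
apply: eq_row3; rewrite !(ptE, mxE) /=; apply/eqP; rewrite -subr_eq0; apply/eqP.
- by transitivity X; first by rewrite /X /n; ring.
- by transitivity (- l * p 0 2 * Y); [rewrite /Y /n; ring | rewrite Y0 mulr0].
- by transitivity (l * p 0 1 * Y); [rewrite /Y /n; ring | rewrite Y0 mulr0].
Qed.

(** At a point of tangency [fregier_map] multiplies by [l], in agreement with the convention f = p;
    elsewhere the common points of all hypotenuses are the multiples of [fregier_map p]. *)
Lemma fregier_pointP p f : conic C p ->
  fregier_point N C p f <-> f != 0 /\ (f == fregier_map p)%MS.
Proof.
move=> Cp.
have Ez : p 0 0 = 0 -> fregier_map p = l *: p.
  by move=> z; apply: eq_row3; rewrite !(ptE, mxE) /= ?z ?mulr0.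
have eqE : p 0 0 = 0 -> (f == fregier_map p)%MS = (f == p)%MS.
  by move/Ez->; rewrite !(eqmx_scale _ l0).
have hypP g : p 0 0 != 0 ->
    (forall q r, right_triangle N C p q r -> (g <= q + r)%MS) <->
    (g <= fregier_map p)%MS.
  move=> z; split=> [|gf q r /fregier_map_hypotenuse]; first exact: sub_fregier_map.
  exact: submx_trans.
split=> [[f0 tan ntan]|[f0 ef]]; split=> //.
- have [z|z] := eqVneq (p 0 0) 0; first by rewrite eqE //; apply/tan/tangent_circleP.
  have {ntan}fP g : (g <= fregier_map p)%MS <-> (g <= f)%MS.
    rewrite -hypP //; apply: ntan.
    by move/(tangent_circleP Cp)/eqP; apply/negP.
  by apply/andP; split; [apply/fP | apply/fP].
- by move/(tangent_circleP Cp)=> /eqE <-.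
- move=> ntan g; rewrite hypP; first by rewrite (eqmxP ef).
  by apply/eqP => z; apply/ntan/tangent_circleP.
Qed.

(** * The Fregier locus as the image of the circle *)

Lemma fregier_locusP f :
  fregier_locus N C f <-> f != 0 /\ exists2 p, conic C p & f = fregier_map p.
Proof.
split=> [[p Cp /(fregier_pointP _ Cp)[f0 /andP[/sub_rVP[c ef] _]]]|[f0 [p Cp ef]]].
  (* The proportionality factor is absorbed into the point, as the conic is closed under nonzero
     scaling. *)
  split=> //; exists (c *: p); last by rewrite fregier_mapZ.
  have [p0 eC] := (conic_circleP p).1 Cp; apply/conic_circleP; split.
    rewrite scaler_eq0 (negPf p0) orbF; apply: contra_neq f0 => c0.
    by rewrite ef c0 scale0r.
  rewrite !mxE; transitivity (c ^+ 2 * ((l + 1) * (p 0 1 ^+ 2 + p 0 2 ^+ 2)));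
    first by ring.
  by rewrite eC; ring.
by exists p => //; apply/(fregier_pointP _ Cp); rewrite ef submx_refl -ef.
Qed.

(** [A] is the form of [C] composed with the inverse of [fregier_map]. *)
Lemma fregier_locus_conic : l + 2 != 0 ->
  let A := diag3 (- l / (l + 2) ^+ 2) ((l + 1) / l ^+ 2) ((l + 1) / l ^+ 2) in
  regular A /\ fregier_locus N C = conic A.
Proof.
move=> l2 A; split.
  by rewrite regular_diag3 !mulf_neq0 ?invr_eq0 ?oppr_eq0 ?expf_neq0.
have AP f : dot (f *m A) f = (l + 1) * ((f 0 1 / l) ^+ 2 + (f 0 2 / l) ^+ 2)
     - l * (f 0 0 / (l + 2)) ^+ 2.
  by rewrite mul_row_diag3 /dot !ptE; field; rewrite l0 l2.
apply/seteqP; split=> f.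
  case/fregier_locusP=> f0 [p /conic_circleP[_ eC] ef]; apply/conicP; split=> //.
  rewrite AP ef !ptE ![_ * p _ _]mulrC !mulfK // eC subrr //.
case/conicP=> f0; rewrite AP => /subr0_eq eC; apply/fregier_locusP; split=> //.
have ef : f = fregier_map (pt (f 0 0 / (l + 2)) (f 0 1 / l) (f 0 2 / l)).
  by apply: eq_row3; rewrite !ptE mulrC mulfVK.
exists (pt (f 0 0 / (l + 2)) (f 0 1 / l) (f 0 2 / l)) => //.
apply/conic_circleP; rewrite !ptE; split=> //; apply: contra_neq f0 => E.
by rewrite ef E fregier_map0.
Qed.

Lemma fregier_locus_line : l = -2 ->
  fregier_locus N C = [set x : 'rV[K]_3 | x != 0 /\ x ord0 ord0 = 0].
Proof.
move=> el; apply/seteqP; split=> f.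
  case/fregier_locusP=> f0 [p _ ef]; split=> //.
  by rewrite -[LHS]/(f 0 0) ef ptE el addNr mul0r.
case=> f0 z; apply/fregier_locusP; split=> //.
(* The value of p0^2 forced by the equation of [C]; p0 itself is free for the image when [l = -2],
   so any square root serves. *)
pose c := (l + 1) / l * ((f 0 1 / l) ^+ 2 + (f 0 2 / l) ^+ 2).
have ef : f = fregier_map (pt (sqrtC c) (f 0 1 / l) (f 0 2 / l)).
  apply: eq_row3; rewrite !ptE; first by rewrite el addNr mul0r.
    by rewrite mulrC mulfVK.
  by rewrite mulrC mulfVK.
exists (pt (sqrtC c) (f 0 1 / l) (f 0 2 / l)) => //.
apply/conic_circleP; rewrite !ptE; split.
  by apply: contra_neq f0 => E; rewrite ef E fregier_map0.
by rewrite sqrtCK /c mulrA [l * _]mulrC mulfVK.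
Qed.

(** A form vanishing on all of x0 = 0 has a zero block in rows and columns 1, 2, seen at (1,0),
    (0,1) and (1,1). A symmetric 3 by 3 matrix with such a block has determinant 0. *)
Lemma conic_regular_not_line (A : 'M[K]_3) : regular A ->
  conic A <> [set x : 'rV[K]_3 | x != 0 /\ x ord0 ord0 = 0].
Proof.
case/andP=> /eqP sA; rewrite unitmxE unitfE => detA eA.
have a21 : A 2 1 = A 1 2 by rewrite -[in LHS]sA mxE.
have Az x1 x2 : x1 != 0 \/ x2 != 0 ->
    A 1 1 * x1 ^+ 2 + 2 * A 1 2 * x1 * x2 + A 2 2 * x2 ^+ 2 = 0.
  move=> x0; have : conic A (pt 0 x1 x2).
    rewrite eA; split; last by rewrite mxE.
    by rewrite row3_eq0 !ptE eqxx; case: x0 => /negPf->; rewrite ?andbF.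
  case/conicP=> _; rewrite /dot !mxE !sum_ord3 !ptE a21 /= => <-.
  ring.
have a11 : A 1 1 = 0.
  by have := Az 1 0 (or_introl (oner_neq0 _)) => <-; ring.
have a22 : A 2 2 = 0.
  by have := Az 0 1 (or_intror (oner_neq0 _)) => <-; ring.
have a12 : A 1 2 = 0.
  have := Az 1 1 (or_introl (oner_neq0 _)); rewrite a11 a22 => /eqP.
  by rewrite !mul0r add0r addr0 !mulr1 mulf_eq0 pnatr_eq0 => /eqP.
by case/eqP: detA; rewrite det3 a11 a22 a21 a12; ring.
Qed.

(** * The two points of tangency and their span *)

Lemma circle_double_contact (i0 : K) : i0 ^+ 2 = -1 ->
  circle N C (pt 0 1 i0) (pt 0 1 (- i0)).
Proof.
move=> i2; have i0n : i0 != 0.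
  by apply/eqP=> E; move/eqP: i2; rewrite E expr0n eq_sym oppr_eq0 oner_eq0.
have pn0 s : pt 0 1 s != 0 :> 'rV[K]_3 by rewrite row3_eq0 !ptE oner_eq0 andbF.
have Np s : s ^+ 2 = -1 -> conic N (pt 0 1 s).
  by move=> s2; apply/conic_absoluteP; rewrite !ptE s2; split=> //; ring.
have Cp s : s ^+ 2 = -1 -> conic C (pt 0 1 s).
  by move=> s2; apply/conic_circleP; rewrite !ptE s2; split=> //; ring.
have Tp s : s ^+ 2 = -1 -> tangent_at N C (pt 0 1 s).
  by move=> s2; apply/tangent_circleP; [apply: Cp | rewrite ptE].
split; first by rewrite regular_diag3 !mulf_neq0 ?oppr_eq0.
split; [by [] | | | exact: Tp | by apply: Tp; rewrite sqrrN].
  apply/negP=> /andP[/sub_rVP[c E] _].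
  have := congr1 (fun x : 'rV[K]_3 => x 0 1) E; rewrite !mxE /= mulr1 => c1.
  have := congr1 (fun x : 'rV[K]_3 => x 0 2) E; rewrite !mxE /= -c1 mul1r.
  by move/eqP; rewrite -addr_eq0 -mulr2n mulrn_eq0 (negPf i0n).
apply/seteqP; split=> [p [Np' Cp']|p].
  have [p0 eN] := (conic_absoluteP p).1 Np'.
  have z : p 0 0 = 0.
    apply/eqP; rewrite -sqrf_eq0; apply/eqP.
    have [_ eC] := (conic_circleP p).1 Cp'.
    transitivity ((l + 1) * p 0 0 ^+ 2 - l * p 0 0 ^+ 2); first by ring.
    by rewrite -eC eN subrr.
  have eqp s : p 0 2 = s * p 0 1 -> (p == pt 0 1 s)%MS.
    move=> E; have -> : p = p 0 1 *: pt 0 1 s.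
      by apply: eq_row3; rewrite mxE !ptE ?mulr0 ?mulr1 // mulrC.
    apply/eqmxP/eqmx_scale; apply: contra_neq p0 => p1.
    by apply: eq_row3; rewrite !mxE // E p1 mulr0.
  (* On x0 = 0 the equation of [N] becomes x1^2 + x2^2 = 0, which factors over [i0] into the two
     points of tangency. *)
  have : (p 0 2 - i0 * p 0 1) * (p 0 2 + i0 * p 0 1) = 0.
    transitivity (p 0 1 ^+ 2 + p 0 2 ^+ 2 - (1 + i0 ^+ 2) * p 0 1 ^+ 2); first by ring.
    by rewrite eN z i2; ring.
  move/eqP; rewrite mulf_eq0 => /orP[]; [left|right]; apply: eqp.
    by apply/eqP; rewrite -subr_eq0.
  by apply/eqP; rewrite -subr_eq0 mulNr opprK.
have onCN s : s ^+ 2 = -1 -> (p == pt 0 1 s)%MS -> (conic N `&` conic C) p.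
  move=> s2 /andP[/sub_rVP[c ->] ]; have [->|c0 _] := eqVneq c 0.
    by rewrite scale0r => /sub_rVP[d]; rewrite scaler0 => /eqP; rewrite (negPf (pn0 s)).
  have cn : c *: pt 0 1 s != 0 by rewrite scaler_eq0 (negPf c0) (negPf (pn0 s)).
  split; [apply/conic_absoluteP | apply/conic_circleP]; split=> //;
    by rewrite !mxE /=; ring: s2.
by case; apply: onCN; rewrite ?sqrrN.
Qed.

Lemma line_points (i0 : K) : i0 ^+ 2 = -1 ->
  points (pt 0 1 i0 + pt 0 1 (- i0))%MS =
  [set x : 'rV[K]_3 | x != 0 /\ x ord0 ord0 = 0].
Proof.
move=> i2; apply/seteqP; split=> x [x0].
  by move/span2P=> [a [b E]]; split=> //; rewrite E !mxE /=; ring.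
move=> z; split=> //; apply/span2P.
(* Solution of a + b = x1 and i0 (a - b) = x2, using 1 / i0 = - i0. *)
exists ((x 0 1 - i0 * x 0 2) / 2), ((x 0 1 + i0 * x 0 2) / 2).
apply: eq_row3; rewrite !mxE /=.
- by rewrite [x 0 0]z; ring.
- by field.
- transitivity (- i0 ^+ 2 * x 0 2); first by rewrite i2; ring.
  by field.
Qed.

End Circles.

(** * Specialization to the complex plane with a real parameter *)

Lemma absoluteE (R : realType) : absolute = diag3 (-1) 1 1 :> 'M[R[i]]_3.
Proof. by []. Qed.

Lemma circle_mxE (R : realType) (lambda : R) :
  circle_mx lambda =
  diag3 (- lambda%:C%C) (lambda%:C%C + 1) (lambda%:C%C + 1).
Proof.
rewrite /circle_mx absoluteE /diag3 -linearZ -linearD; congr diag_mx.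
by apply: eq_row3; rewrite !mxE /=; ring.
Qed.

Theorem mainTheorem8 (R : realType) (lambda : R)
    (hlambda0 : lambda <> 0) (hlambda1 : lambda <> -1) :
  let N : 'M[R[i]]_3 := absolute in
  let C : 'M[R[i]]_3 := circle_mx lambda in
  let t1 : 'rV[R[i]]_3 := pt 0 1 'i%C in
  let t2 : 'rV[R[i]]_3 := pt 0 1 (- 'i%C) in
  let F := fregier_locus N C in
  circle N C t1 t2 /\
  (singular F <-> lambda = -2) /\
  (lambda = -2 ->
     F = points (t1 + t2)%MS /\
     F = [set x : 'rV[R[i]]_3 | x != 0 /\ x ord0 ord0 = 0]).
Proof.
rewrite absoluteE circle_mxE => N C t1 t2 F.
have i2 : ('i%C : R[i]) ^+ 2 = -1 by exact: sqr_i.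
have l0 : lambda%:C%C != 0 :> R[i] by rewrite (inj_eq (@complexI R)); apply/eqP.
have l1 : lambda%:C%C + 1 != 0 :> R[i].
  rewrite -(rmorph1 (real_complex R)) -rmorphD (inj_eq (@complexI R)) addr_eq0.
  exact/eqP.
have line : lambda = -2 -> F = [set x : 'rV[R[i]]_3 | x != 0 /\ x ord0 ord0 = 0].
  by move=> e; apply: fregier_locus_line => //; rewrite e rmorphN rmorph_nat.
split; first exact: circle_double_contact.
split; last by move=> /line FE; rewrite FE line_points.
split=> [sing|/line FE [A rA]]; last first.
  by rewrite FE => /esym; apply: conic_regular_not_line.
have [/eqP|l2] := eqVneq (lambda%:C%C + 2) (0 : R[i]).
  rewrite -(rmorph_nat (real_complex R)) -rmorphD (inj_eq (@complexI R)) addr_eq0.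
  by move/eqP.
(* For [lambda] other than -2 the explicit image conic is regular and contradicts singularity. *)
have [rA FA] := fregier_locus_conic l0 l1 l2.
by case: sing; exists (diag3 (- lambda%:C%C / (lambda%:C%C + 2) ^+ 2)
  ((lambda%:C%C + 1) / lambda%:C%C ^+ 2) ((lambda%:C%C + 1) / lambda%:C%C ^+ 2)).
Qed.
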